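(* There does not exist any C-reducible twisted product Finsler manifold. That is, if $(M_1,F_1)$, $(M_2,F_2)$ are Finsler manifolds and $f:M_1\times M_2\to\mathbb{R}^+$ is smooth, then the twisted product $(M_1\times_f M_2,F)$ is never C-reducible.
   Context: A Finsler metric is a function on the tangent bundle, smooth on the slit tangent bundle, positively 1-homogeneous on fibres, with positive definite fundamental tensor. Let $(M_1,F_1)$, $(M_2,F_2)$ be Finsler manifolds of dimensions $n_1,n_2$ and $f:M_1\times M_2\to\mathbb{R}^+$ smooth. The twisted product $M_1\times_f M_2$ is $M=M_1\times M_2$, $n=n_1+n_2$, with $F=\sqrt{F_1^2(x,y)+f^2(x,u)F_2^2(u,v)}$, considered at points with $y\in T_xM_1$, $v\in T_uM_2$, $y\ne0$, $v\ne 0$. Local coordinates are $\mathbf{x}^a=(x^i,u^\alpha)$ with fibre coordinates $\mathbf{y}^a=(y^i,v^\alpha)$. Put $\mathbf g_{ab}=\frac12\frac{\partial^2F^2}{\partial\mathbf y^a\partial\mathbf y^b}$, $\mathbf y_a=\mathbf g_{ab}\mathbf y^b$, Cartan tensor $\mathbf C_{abc}=\frac12\frac{\partial \mathbf g_{ab}}{\partial\mathbf y^c}$, mean Cartan torsion $\mathbf I_a=\mathbf g^{bc}\mathbf C_{abc}$, angular metric $\mathbf h_{ab}=\mathbf g_{ab}-\frac1{F^2}\mathbf y_a\mathbf y_b$. $F$ is C-reducible if it is non-Riemannian (i.e. $\mathbf C_{abc}$ is not identically zero) and its Matsumoto tensor vanishes: $$\mathbf C_{abc}-\frac1{n+1}\{\mathbf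 I_a\mathbf h_{bc}+\mathbf I_b\mathbf h_{ac}+\mathbf I_c\mathbf h_{ab}\}=0 .$$ *)

(* Defs.v *)
From HB Require Import structures.
From mathcomp Require Import all_boot all_order all_algebra.
From mathcomp Require Import all_classical all_reals all_analysis.

Set Implicit Arguments.
Unset Strict Implicit.
Unset Printing Implicit Defensive.

Import Order.TTheory GRing.Theory Num.Theory.
Import numFieldNormedType.Exports.

Local Open Scope classical_set_scope.
Local Open Scope ring_scope.

Definition partial (R : realType) (n : nat) (a : 'I_n) (f : 'rV[R]_n -> R) :
    'rV[R]_n -> R :=
  fun x => 'D_(delta_mx 0 a : 'rV[R]_n) f x.

Fixpoint Ck (R : realType) (n : nat) (k : nat) (U : set 'rV[R]_n)
    (f : 'rV[R]_n -> R) : Prop :=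
  match k with
  | 0%N => forall x, U x -> {for x, continuous f}
  | k'.+1 => (forall x, U x -> differentiable f x) /\
             (forall a : 'I_n, Ck k' U (partial a f))
  end.

(* Meant for open [U]. *)
Definition smooth_on (R : realType) (n : nat) (U : set 'rV[R]_n)
    (f : 'rV[R]_n -> R) : Prop :=
  forall k, Ck k U f.

(* A smooth atlas indexed by [chart]; [coord i] and [param i] are mutually
   inverse homeomorphisms between [dom i] and the open set [coord i @` dom i],
   with irrelevant values outside of these sets. *)
Record manifold (R : realType) (n : nat) := Manifold {
  points :> topologicalType ;
  chart : Type ;
  dom : chart -> set points ;
  coord : chart -> points -> 'rV[R]_n ;
  param : chart -> 'rV[R]_n -> points ;
  manifold_hausdorff : hausdorff_space points ;
  manifold_second_countable : @second_countable points ;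
  open_dom : forall i, open (dom i) ;
  open_coord : forall i, open (coord i @` dom i) ;
  coordK : forall i p, dom i p -> param i (coord i p) = p ;
  chart_continuous : forall i p, dom i p -> {for p, continuous (coord i)} ;
  param_continuous : forall i x, (coord i @` dom i) x ->
    {for x, continuous (param i)} ;
  dom_cover : forall p, exists i, dom i p ;
  transition_smooth : forall i j (a : 'I_n),
    smooth_on (coord i @` (dom i `&` dom j))
      (fun x => coord j (param i x) 0 a)
}.

Definition transition (R : realType) (n : nat) (M : manifold R n)
    (i j : chart M) (x : 'rV[R]_n) : 'rV[R]_n :=
  coord j (param i x).

Definition smooth_function (R : realType) (n : nat) (M : manifold R n)
    (f : M -> R) : Prop :=
  forall i : chart M, smooth_on (coord i @` dom i) (fun x => f (param i x)).

(* A real function on the tangent bundle: [F i p y] is its value at the tangent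
   vector at [p] whose components in the chart [i] are [y].  As a tangent vector
   at [p] is a class of pairs [(i, y)] modulo the differentials of the
   transition maps, [F] must be constant on these classes. *)
Record tangent_function (R : realType) (n : nat) (M : manifold R n) :=
  TangentFunction {
  tangent_fun :> chart M -> M -> 'rV[R]_n -> R ;
  tangent_fun_change : forall (i j : chart M) (p : M) (y : 'rV[R]_n),
    dom i p -> dom j p ->
    tangent_fun j p ('D_y (transition i j) (coord i p)) = tangent_fun i p y
}.

(* Tensors at a tangent vector, in components; [L] is the restriction to one
   fibre, in the coordinates of a chart, of a function on the tangent bundle. *)

Definition fundamental_tensor (R : realType) (n : nat) (L : 'rV[R]_n -> R)
    (y : 'rV[R]_n) : 'M[R]_n :=
  \matrix_(a, b) (2^-1 * partial a (partial b (fun z => L z ^+ 2)) y).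

Definition lowered (R : realType) (n : nat) (L : 'rV[R]_n -> R)
    (y : 'rV[R]_n) (a : 'I_n) : R :=
  \sum_b fundamental_tensor L y a b * y 0 b.

Definition cartan_tensor (R : realType) (n : nat) (L : 'rV[R]_n -> R)
    (y : 'rV[R]_n) (a b c : 'I_n) : R :=
  2^-1 * partial c (fun z => fundamental_tensor L z a b) y.

Definition mean_cartan (R : realType) (n : nat) (L : 'rV[R]_n -> R)
    (y : 'rV[R]_n) (a : 'I_n) : R :=
  \sum_b \sum_c invmx (fundamental_tensor L y) b c * cartan_tensor L y a b c.

Definition angular_metric (R : realType) (n : nat) (L : 'rV[R]_n -> R)
    (y : 'rV[R]_n) (a b : 'I_n) : R :=
  fundamental_tensor L y a b - (L y ^+ 2)^-1 * (lowered L y a * lowered L y b).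

Definition matsumoto_tensor (R : realType) (n : nat) (L : 'rV[R]_n -> R)
    (y : 'rV[R]_n) (a b c : 'I_n) : R :=
  cartan_tensor L y a b c -
  n.+1%:R^-1 * (mean_cartan L y a * angular_metric L y b c +
                mean_cartan L y b * angular_metric L y a c +
                mean_cartan L y c * angular_metric L y a b).

Definition positive_definite (R : realType) (n : nat) (g : 'M[R]_n) : Prop :=
  forall w : 'rV[R]_n, w != 0 -> 0 < (w *m g *m w^T) 0 0.

Record finsler_metric (R : realType) (n : nat) (M : manifold R n)
    (F : tangent_function M) : Prop := FinslerMetric {
  finsler_smooth : forall i : chart M,
    smooth_on
      [set z : 'rV[R]_(n + n) |
        (coord i @` dom i) (lsubmx z) /\ rsubmx z != 0]
      (fun z => F i (param i (lsubmx z)) (rsubmx z)) ;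
  finsler_homogeneous : forall (i : chart M) (p : M) (t : R) (y : 'rV[R]_n),
    dom i p -> 0 < t -> F i p (t *: y) = t * F i p y ;
  finsler_positive_definite : forall (i : chart M) (p : M) (y : 'rV[R]_n),
    dom i p -> y != 0 -> positive_definite (fundamental_tensor (F i p) y)
}.

(* [D] is the set of tangent vectors (in components; the set is meant not to
   depend on the chart) at which [F] is considered. *)
Definition c_reducible (R : realType) (n : nat) (M : manifold R n)
    (D : set 'rV[R]_n) (F : tangent_function M) : Prop :=
  (exists (i : chart M) (p : M) (y : 'rV[R]_n) (a b c : 'I_n),
     [/\ dom i p, D y & cartan_tensor (F i p) y a b c <> 0]) /\
  (forall (i : chart M) (p : M) (y : 'rV[R]_n) (a b c : 'I_n),
     dom i p -> D y -> matsumoto_tensor (F i p) y a b c = 0).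

Section ProductManifold.
Context (R : realType) (n1 n2 : nat) (M1 : manifold R n1) (M2 : manifold R n2).
Notation Chart := (chart M1 * chart M2)%type.
Notation M12 := (points M1 * points M2)%type.

Definition prod_dom (i : Chart) : set M12 := dom i.1 `*` dom i.2.

Definition prod_coord (i : Chart) (p : M12) : 'rV[R]_(n1 + n2) :=
  row_mx (coord i.1 p.1) (coord i.2 p.2).

Definition prod_param (i : Chart) (x : 'rV[R]_(n1 + n2)) : M12 :=
  (param i.1 (lsubmx x), param i.2 (rsubmx x)).

Lemma prod_hausdorff : hausdorff_space M12.
Proof.
move=> [p1 p2] [q1 q2] cl; congr pair.
- apply: (manifold_hausdorff (m := M1)) => A B pA qB.
  have [||[a b] []] := cl (A `*` setT) (B `*` setT).
  + by exists (A, setT) => //; split => //; exact: filterT.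
  + by exists (B, setT) => //; split => //; exact: filterT.
  + by move=> /= [Aa _] [Ba _]; exists a.
- apply: (manifold_hausdorff (m := M2)) => A B pA qB.
  have [||[a b] []] := cl (setT `*` A) (setT `*` B).
  + by exists (setT, A) => //; split => //; exact: filterT.
  + by exists (setT, B) => //; split => //; exact: filterT.
  + by move=> /= [_ Ab] [_ Bb]; exists b.
Qed.

Lemma open_setX (A : set M1) (B : set M2) :
  open A -> open B -> open (A `*` B : set M12).
Proof.
rewrite !openE => oA oB [p q] [Ap Bq]; exists (A, B) => //.
by split; [exact: oA | exact: oB].
Qed.

Lemma prod_second_countable : @second_countable M12.
Proof.
have [B1 cB1 [oB1 nB1]] := manifold_second_countable M1.
have [B2 cB2 [oB2 nB2]] := manifold_second_countable M2.
exists ((fun AB => AB.1 `*` AB.2) @` (B1 `*` B2)).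
  exact/(sub_countable (card_image_le _ _))/countableX.
split=> [_ [[A B] [/oB1 oA /oB2 oB] <-]|[p q] W [[U V] [/= Up Vq] UVW]].
  exact: open_setX.
have [A [B1A Ap] AU] := nB1 p U Up.
have [B [B2B Bq] BV] := nB2 q V Vq.
exists (A `*` B); first by split => //; exists (A, B).
by move=> [a b] [/AU Ua /BV Vb]; exact: UVW.
Qed.

Lemma prod_coord_image i :
  prod_coord i @` prod_dom i =
  [set x | (coord i.1 @` dom i.1) (lsubmx x) /\
           (coord i.2 @` dom i.2) (rsubmx x)].
Proof.
apply/seteqP; split=> [_ [[p q] [/= Dp Dq] <-]|x /= [[p Dp px] [q Dq qx]]].
  by rewrite /prod_coord /= row_mxKl row_mxKr; split; [exists p | exists q].
by exists (p, q) => //; rewrite /prod_coord /= px qx hsubmxK.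
Qed.

Lemma open_prod_coord i : open (prod_coord i @` prod_dom i).
Proof.
rewrite prod_coord_image; apply: openI.
  apply: (open_comp (f := lsubmx)); last exact: open_coord.
  by move=> x _; exact: continuous_lsubmx.
apply: (open_comp (f := rsubmx)); last exact: open_coord.
by move=> x _; exact: continuous_rsubmx.
Qed.

Lemma prod_coord_continuous i p :
  prod_dom i p -> {for p, continuous (prod_coord i)}.
Proof.
case: p => p q [/= Dp Dq] A /nbhs_ballP[e /= e0 eA].
have cp := chart_continuous Dp; have cq := chart_continuous Dq.
have Np : nbhs p (coord i.1 @^-1` ball (coord i.1 p) e).
  by apply: cp; exact: nbhsx_ballx.
have Nq : nbhs q (coord i.2 @^-1` ball (coord i.2 q) e).
  by apply: cq; exact: nbhsx_ballx.
exists (coord i.1 @^-1` ball (coord i.1 p) e,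
        coord i.2 @^-1` ball (coord i.2 q) e) => //.
move=> [a b] [Ba Bb]; move: Ba Bb => /= [_ Ba] [_ Bb]; apply: eA; split => // k l.
rewrite !mxE; case: fintype.split => m; [exact: Ba | exact: Bb].
Qed.

Lemma prod_param_continuous i x : (prod_coord i @` prod_dom i) x ->
  {for x, continuous (prod_param i)}.
Proof.
rewrite prod_coord_image => -[Dl Dr].
have c1 : {for x, continuous (param i.1 \o lsubmx)}.
  apply: continuous_comp; first exact: continuous_lsubmx.
  exact: param_continuous Dl.
have c2 : {for x, continuous (param i.2 \o rsubmx)}.
  apply: continuous_comp; first exact: continuous_rsubmx.
  exact: param_continuous Dr.
exact: (cvg_pair c1 c2).
Qed.

Lemma derive_lsubmx (V : normedModType R) (f : 'rV[R]_n1 -> V)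
    (v x : 'rV[R]_(n1 + n2)) :
  'D_v (fun z => f (lsubmx z)) x = 'D_(lsubmx v) f (lsubmx x).
Proof.
have E (h : R) : lsubmx (h *: v + x) = h *: lsubmx v + lsubmx x.
  by apply/matrixP => k l; rewrite !mxE.
by rewrite /derive; under eq_fun do rewrite /= E.
Qed.

Lemma derive_rsubmx (V : normedModType R) (f : 'rV[R]_n2 -> V)
    (v x : 'rV[R]_(n1 + n2)) :
  'D_v (fun z => f (rsubmx z)) x = 'D_(rsubmx v) f (rsubmx x).
Proof.
have E (h : R) : rsubmx (h *: v + x) = h *: rsubmx v + rsubmx x.
  by apply/matrixP => k l; rewrite !mxE.
by rewrite /derive; under eq_fun do rewrite /= E.
Qed.

Lemma Ck0 (n k : nat) (U : set 'rV[R]_n) : Ck k U (fun=> 0).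
Proof.
elim: k => [|k IH] /=; first by move=> x _; exact: cst_continuous.
split=> [x _|a]; first exact: differentiable_cst.
by rewrite (_ : partial a _ = fun=> 0)//; apply/funext => x;
   rewrite /partial derive_cst.
Qed.

Lemma Ck_lsubmx k (U : set 'rV[R]_n1) (W : set 'rV[R]_(n1 + n2)) f :
  (forall x, W x -> U (lsubmx x)) -> Ck k U f ->
  Ck k W (fun x => f (lsubmx x)).
Proof.
move=> WU; elim: k f => [|k IH] f /=.
  move=> cf x /WU Ux; apply: (@continuous_comp _ _ _ lsubmx f).
    exact: continuous_lsubmx.
  exact: cf.
move=> [df cf]; split=> [x /WU Ux|a].
  apply: (@differentiable_comp _ _ _ _ lsubmx f).
    exact: differentiable_lsubmx.
  exact: df.
rewrite -(splitK a); case: fintype.split => b /=.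
  rewrite (_ : partial _ _ = fun x => partial b f (lsubmx x)).
    exact: IH (cf b).
  apply/funext => x; rewrite /partial derive_lsubmx; congr ('D_ _ _ _).
  by apply/matrixP => u v; rewrite !mxE eq_lshift.
rewrite (_ : partial _ _ = fun=> 0); first exact: Ck0.
apply/funext => x; rewrite /partial derive_lsubmx.
have -> : lsubmx (delta_mx 0 (rshift n1 b) : 'rV[R]_(n1 + n2)) = 0.
  by apply/matrixP => u v; rewrite !mxE eq_lrshift andbF.
exact: derive0.
Qed.

Lemma Ck_rsubmx k (U : set 'rV[R]_n2) (W : set 'rV[R]_(n1 + n2)) f :
  (forall x, W x -> U (rsubmx x)) -> Ck k U f ->
  Ck k W (fun x => f (rsubmx x)).
Proof.
move=> WU; elim: k f => [|k IH] f /=.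
  move=> cf x /WU Ux; apply: (@continuous_comp _ _ _ rsubmx f).
    exact: continuous_rsubmx.
  exact: cf.
move=> [df cf]; split=> [x /WU Ux|a].
  apply: (@differentiable_comp _ _ _ _ rsubmx f).
    exact: differentiable_rsubmx.
  exact: df.
rewrite -(splitK a); case: fintype.split => b /=; last first.
  rewrite (_ : partial _ _ = fun x => partial b f (rsubmx x)).
    exact: IH (cf b).
  apply/funext => x; rewrite /partial derive_rsubmx; congr ('D_ _ _ _).
  by apply/matrixP => u v; rewrite !mxE eq_rshift.
rewrite (_ : partial _ _ = fun=> 0); first exact: Ck0.
apply/funext => x; rewrite /partial derive_rsubmx.
have -> : rsubmx (delta_mx 0 (lshift n2 b) : 'rV[R]_(n1 + n2)) = 0.
  by apply/matrixP => u v; rewrite !mxE eq_rlshift andbF.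
exact: derive0.
Qed.

Lemma prod_transition_smooth i j (a : 'I_(n1 + n2)) :
  smooth_on (prod_coord i @` (prod_dom i `&` prod_dom j))
    (fun x => prod_coord j (prod_param i x) 0 a).
Proof.
move=> k; rewrite -(splitK a); case: fintype.split => b /=.
  rewrite (_ : (fun x => _) =
      fun x => (fun z => coord j.1 (param i.1 z) 0 b) (lsubmx x)); last first.
    by apply/funext => x; rewrite /prod_coord row_mxEl.
  apply: Ck_lsubmx (transition_smooth i.1 j.1 b k).
  move=> _ [[p q] [[/= ? ?] [/= ? ?]] <-].
  by rewrite /prod_coord row_mxKl; exists p.
rewrite (_ : (fun x => _) =
    fun x => (fun z => coord j.2 (param i.2 z) 0 b) (rsubmx x)); last first.
  by apply/funext => x; rewrite /prod_coord row_mxEr.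
apply: Ck_rsubmx (transition_smooth i.2 j.2 b k).
move=> _ [[p q] [[/= ? ?] [/= ? ?]] <-].
by rewrite /prod_coord row_mxKr; exists q.
Qed.

Lemma prod_coordK i p : prod_dom i p -> prod_param i (prod_coord i p) = p.
Proof.
case: p => p q [/= Dp Dq].
by rewrite /prod_param /prod_coord row_mxKl row_mxKr !coordK.
Qed.

Lemma prod_dom_cover p : exists i, prod_dom i p.
Proof.
have [i1 D1] := dom_cover p.1; have [i2 D2] := dom_cover p.2.
by exists (i1, i2).
Qed.

Definition prod_manifold : manifold R (n1 + n2) :=
  @Manifold R (n1 + n2) M12 Chart prod_dom prod_coord prod_param
    prod_hausdorff prod_second_countable
    (fun i => open_setX (open_dom i.1) (open_dom i.2))
    open_prod_coord prod_coordK prod_coord_continuous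
    prod_param_continuous prod_dom_cover prod_transition_smooth.

End ProductManifold.

Lemma derivable_transition (R : realType) (n : nat) (M : manifold R n)
    (i j : chart M) (p : M) (v : 'rV[R]_n) :
  dom i p -> dom j p -> derivable (transition i j) (coord i p) v.
Proof.
move=> Di Dj; apply/derivable_mxP => u a; rewrite (ord1 u).
have [+ _] := transition_smooth i j a 1.
by move=> /(_ (coord i p)) df; apply: diff_derivable; apply: df; exists p.
Qed.

Section TwistedProduct.
Context (R : realType) (n1 n2 : nat) (M1 : manifold R n1) (M2 : manifold R n2).
Context (F1 : tangent_function M1) (F2 : tangent_function M2).
Context (f : prod_manifold M1 M2 -> R).

Definition twisted_fun (i : chart (prod_manifold M1 M2))
    (p : prod_manifold M1 M2) (w : 'rV[R]_(n1 + n2)) : R :=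
  Num.sqrt (F1 i.1 p.1 (lsubmx w) ^+ 2 +
            f p ^+ 2 * F2 i.2 p.2 (rsubmx w) ^+ 2).

Lemma derive_prod_transition (i j : chart (prod_manifold M1 M2))
    (p : prod_manifold M1 M2) (w : 'rV[R]_(n1 + n2)) :
  dom i p -> dom j p ->
  'D_w (transition i j) (coord i p) =
  row_mx ('D_(lsubmx w) (transition i.1 j.1) (coord i.1 p.1))
         ('D_(rsubmx w) (transition i.2 j.2) (coord i.2 p.2)).
Proof.
move=> Di Dj.
rewrite (derive_mx (@derivable_transition _ _ _ _ _ _ _ Di Dj)).
case: p Di Dj => p q [/= Di1 Di2] [/= Dj1 Dj2].
rewrite (derive_mx (@derivable_transition _ _ _ _ _ _ _ Di1 Dj1)).
rewrite (derive_mx (@derivable_transition _ _ _ _ _ _ _ Di2 Dj2)).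
apply/matrixP => u a; rewrite (ord1 u) mxE -(splitK a).
case: fintype.split => b /=.
  rewrite row_mxEl mxE.
  rewrite (_ : (fun t => _) =
      fun t => (fun z => transition i.1 j.1 z 0 b) (lsubmx t)); last first.
    by apply/funext => x; rewrite /transition /= /prod_coord row_mxEl.
  by rewrite (derive_lsubmx (fun z => transition i.1 j.1 z 0 b)) row_mxKl.
rewrite row_mxEr mxE.
rewrite (_ : (fun t => _) =
    fun t => (fun z => transition i.2 j.2 z 0 b) (rsubmx t)); last first.
  by apply/funext => x; rewrite /transition /= /prod_coord row_mxEr.
by rewrite (derive_rsubmx (fun z => transition i.2 j.2 z 0 b)) row_mxKr.
Qed.

Lemma twisted_fun_change (i j : chart (prod_manifold M1 M2))
    (p : prod_manifold M1 M2) (w : 'rV[R]_(n1 + n2)) :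
  dom i p -> dom j p ->
  twisted_fun j p ('D_w (transition i j) (coord i p)) = twisted_fun i p w.
Proof.
move=> Di Dj; rewrite /twisted_fun derive_prod_transition// row_mxKl row_mxKr.
by case: Di Dj => [? ?] [? ?]; rewrite !tangent_fun_change.
Qed.

Definition twisted_product : tangent_function (prod_manifold M1 M2) :=
  TangentFunction twisted_fun_change.

End TwistedProduct.

(* The metric of a twisted product is in general not smooth at the tangent
   vectors (y, v) with y = 0 or v = 0; these are left out. *)
Definition twisted_slit (R : realType) (n1 n2 : nat) :
    set 'rV[R]_(n1 + n2) :=
  [set w | lsubmx w != 0 /\ rsubmx w != 0].

(* Main.v *)
(* With A = F1^2 and B = f^2 F2^2 the squared metric is A(y) + B(v), so the
   fundamental and Cartan tensors have no mixed components, whereas the angular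
   metric has the mixed components - y_j v_k / F^2.  Contract the vanishing of
   the Matsumoto tensor at (a, j, k), j in the first and k in the second block,
   with y^j v^k: as C_{abc} y^a = 0 separately in each block (Euler), only
   - I_a A(y) B(v) / F^2 survives.  Positive definiteness gives A(y), B(v) > 0,
   hence I = 0, and C-reducibility then forces C = 0. *)
Require Import Defs.
From mathcomp Require Import all_boot all_order all_algebra.
From mathcomp Require Import all_classical all_reals all_analysis.
From mathcomp Require Import ring.

Set Implicit Arguments.
Unset Strict Implicit.
Unset Printing Implicit Defensive.

Import Order.TTheory GRing.Theory Num.Theory.
Import numFieldNormedType.Exports.

Local Open Scope classical_set_scope.
Local Open Scope ring_scope.

(** * Euler's theorem for positively homogeneous functions *)

Section Homogeneous.
Context (R : realType) (n : nat).
Implicit Types (f : 'rV[R]_n -> R) (x v : 'rV[R]_n).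

Lemma derive_sum_partial f x v : differentiable f x ->
  'D_v f x = \sum_a v 0 a * partial a f x.
Proof.
move=> df; rewrite deriveE// {1}(row_sum_delta v) linear_sum /=.
by apply: eq_bigr => a _; rewrite linearZ /= /partial deriveE.
Qed.

(** The two difference quotients coincide. This reduces a directional derivative to one-variable
    calculus. *)
Lemma derive_line f x v : 'D_v f x = 'D_1 (fun t : R => f (t *: v + x)) 0.
Proof.
have E (h : R) : (h *: 1 + 0) *: v + x = h *: v + x.
  by rewrite addr0 /GRing.scale /= mulr1.
by rewrite /derive; under [in RHS]eq_fun do rewrite /= E scale0r add0r.
Qed.

(** The left side is the derivative of [f] at [x] in the direction [x] itself, and along that ray
    homogeneity makes [f] a monomial. *)
Lemma euler f m x : differentiable f x ->
  (forall t, 0 < t -> f (t *: x) = t ^+ m * f x) ->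
  \sum_a x 0 a * partial a f x = m%:R * f x.
Proof.
move=> df hom; rewrite -derive_sum_partial// derive_line.
(* [t *: x + x] is [(t + 1) *: x]; homogeneity covers positive factors only, so the two functions
   agree for [t > -1], which suffices near 0. *)
rewrite (@near_eq_derive _ _ _ _ (fun t : R => (t + 1) ^+ m * f x)).
  have d1 : is_derive (0 : R) (1 : R) (fun t : R => t + 1) 1.
    by apply: is_derive_eq; rewrite addr0.
  have := is_deriveM (is_deriveX m d1) (is_derive_cst (f x) (0 : R) (1 : R)).
  move=> /@derive_val; rewrite /= => E.
  rewrite (_ : (fun t : R => _) = (fun t : R => t + 1) ^+ m * cst (f x)).
    rewrite E /= scaler0 !add0r expr1n mulr1.
    by rewrite /GRing.scale /= mulr1 mulrC.
  by apply/funext => t; rewrite fctE /= exprfctE.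
near=> t; rewrite -[X in _ *: x + X]scale1r -scalerDl hom//.
rewrite -ltrBlDr sub0r; near: t; apply: lt_nbhsr.
by rewrite oppr_lt0.
Unshelve. all: by end_near. Qed.

(** Differentiate [f (t *: y) = t ^+ m.+1 * f y] in [y]: the chain rule puts one factor [t] on the
    left, which is then cancelled. *)
Lemma partial_homogeneous f m a (t : R) x : 0 < t ->
  (forall s y, 0 < s -> f (s *: y) = s ^+ m.+1 * f y) ->
  differentiable f x -> differentiable f (t *: x) ->
  partial a f (t *: x) = t ^+ m * partial a f x.
Proof.
move=> t0 hom dfx dftx; rewrite /partial.
set v : 'rV[R]_n := delta_mx 0 a.
have dt : differentiable (t \*: @idfun 'rV[R]_n) x.
  exact: differentiableZ.
have E : 'D_v (f \o (t \*: @idfun 'rV[R]_n)) x = t * 'D_v f (t *: x).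
  rewrite deriveE; last exact: differentiable_comp.
  rewrite diff_comp//= diffZ//= diff_val/=.
  by rewrite linearZ /= deriveE.
apply: (mulfI (lt0r_neq0 t0)); rewrite -E mulrA -exprS.
rewrite -deriveMl; last exact: diff_derivable.
rewrite (_ : f \o _ = t ^+ m.+1 \*o f)//.
by apply/funext => y /=; rewrite hom.
Qed.

End Homogeneous.

(** * Functions of class C^k on an open set *)

Section Smooth.
Context (R : realType) (n : nat).
Implicit Types (U : set 'rV[R]_n) (f g : 'rV[R]_n -> R) (k : nat).

Lemma CkS_Ck k U f : Ck k.+1 U f -> Ck k U f.
Proof.
elim: k f => [|k IH] f [df pf].
  by move=> x Ux; exact/differentiable_continuous/df.
by split=> // a; exact: IH (pf a).
Qed.

Lemma eq_near_open U f g x : open U -> {in U, f =1 g} -> U x ->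
  \forall y \near x, f y = g y.
Proof.
move=> oU fg Ux; have Un : nbhs x U by exact: open_nbhs_nbhs.
by apply: filterS Un => y Uy; apply: fg; rewrite inE.
Qed.

Lemma partial_eq_in U f g a : open U -> {in U, f =1 g} ->
  {in U, partial a f =1 partial a g}.
Proof.
move=> oU fg x; rewrite inE => Ux; apply: near_eq_derive.
exact: eq_near_open Ux.
Qed.

(** The differential of [f] also serves for [g], because the two first-order remainders agree near
    0. *)
Lemma near_eq_differentiable f g x : (\forall y \near x, f y = g y) ->
  differentiable f x -> differentiable g x.
Proof.
move=> fg df.
have fx : f x = g x by exact: nbhs_singleton fg.
have E : g \o shift x = cst (g x) + 'd f x +o_ 0 id.
  apply/eqaddoP => _/posnumP[e].
  have /eqaddoP /(_ e%:num) := diff_locally df.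
  move=> /(_ (gt0 e)) H.
  have fg0 : \forall h \near (0 : 'rV[R]_n), f (h + x) = g (h + x).
    by move: fg; rewrite (near_shift 0 x) /= subr0.
  near=> h.
  have -> : (g \o shift x - (cst (g x) + 'd f x)) h =
            (f \o shift x - (cst (f x) + 'd f x)) h.
    by rewrite !fctE /= -fx; congr (_ - _); symmetry; near: h.
  by near: h.
have dE : 'd g x = 'd f x :> (_ -> _).
  by apply: diff_unique E; exact: diff_continuous.
by apply/diff_locallyP; rewrite dE; split => //; exact: diff_continuous.
Unshelve. all: by end_near. Qed.

(** [Ck] speaks of functions on the whole space, while the sum and product rules for [partial] are
    available only on [U]; this lemma lets them be used inside [Ck]. *)
Lemma Ck_eq_in k U f g : open U -> {in U, f =1 g} -> Ck k U f -> Ck k U g.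
Proof.
move=> oU; elim: k f g => [|k IH] f g fg /=.
  move=> cf x Ux; have := cf x Ux.
  have gx : f x = g x by apply: fg; rewrite inE.
  rewrite /prop_for /continuous_at -gx => fx; apply: cvg_trans fx.
  exact: (near_eq_cvg (eq_near_open oU fg Ux)).
move=> [df pf]; split=> [x Ux|a]; last first.
  by apply: IH (pf a); apply: partial_eq_in.
exact: near_eq_differentiable (eq_near_open oU fg Ux) (df x Ux).
Qed.

Lemma Ck_add k U f g : open U -> Ck k U f -> Ck k U g ->
  Ck k U (fun x => f x + g x).
Proof.
move=> oU; elim: k f g => [|k IH] f g /=.
  by move=> cf cg x Ux; apply: continuousD; [exact: cf | exact: cg].
move=> [df pf] [dg pg]; split=> [x Ux|a].
  by apply: differentiableD; [exact: df | exact: dg].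
apply: (@Ck_eq_in _ _ (fun x => partial a f x + partial a g x)) => //.
  move=> x; rewrite inE => Ux; rewrite /partial deriveD//.
    exact/diff_derivable/df.
  exact/diff_derivable/dg.
exact: IH.
Qed.

Lemma Ck_mul k U f g : open U -> Ck k U f -> Ck k U g ->
  Ck k U (fun x => f x * g x).
Proof.
move=> oU; elim: k f g => [|k IH] f g.
  by move=> cf cg x Ux; apply: continuousM; [exact: cf | exact: cg].
move=> cf cg; have [df pf] := cf; have [dg pg] := cg.
split=> [x Ux|a]; first by apply: differentiableM; [exact: df | exact: dg].
(* The Leibniz rule keeps one factor undifferentiated, so the induction also needs [f] and [g]
   themselves at order [k], by [CkS_Ck]. *)
apply: (@Ck_eq_in _ _ (fun x => f x * partial a g x + g x * partial a f x)).
- by [].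
- move=> x; rewrite inE => Ux; rewrite /partial deriveM//.
    exact/diff_derivable/df.
  exact/diff_derivable/dg.
- by apply: Ck_add => //; apply: IH;
    [exact: CkS_Ck cf | exact: pg | exact: CkS_Ck cg | exact: pf].
Qed.

Lemma partial_cst (a : 'I_n) (c : R) :
  partial a (fun=> c : R) = fun=> 0.
Proof. by apply/funext => x; rewrite /partial derive_cst. Qed.

Lemma Ck_cst k U (c : R) : Ck k U (fun=> c).
Proof.
case: k => [|k] /=; first by move=> x _; exact: cst_continuous.
split=> [x _|a]; first exact: differentiable_cst.
by rewrite partial_cst; exact: Ck0.
Qed.

End Smooth.

(** * Restriction to a fibre, the base coordinates being fixed *)

Lemma differentiable_row_mx_r (R : realType) (m n : nat) (x : 'rV[R]_m)
    (y : 'rV[R]_n) : differentiable (fun z : 'rV[R]_n => row_mx x z) y.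
Proof.
(* The map is affine: a constant plus a finite sum of coordinate functions times basis vectors. *)
rewrite (_ : (fun z => _) = cst (row_mx x 0) +
    \sum_j (fun z : 'rV[R]_n =>
              z 0 j *: (delta_mx 0 (rshift m j) : 'rV[R]_(m + n)))); last first.
  apply/funext => z; rewrite fctE /= fct_sumE.
  apply/matrixP => u a; rewrite (ord1 u) [RHS]mxE summxE.
  rewrite -(splitK a); case: fintype.split => b /=.
    rewrite !row_mxEl big1 ?addr0// => j _.
    by rewrite !mxE eq_lrshift andbF mulr0.
  rewrite !row_mxEr mxE add0r {1}(row_sum_delta z) summxE.
  by apply: eq_bigr => j _; rewrite !mxE eq_rshift.
apply: differentiableD => //; apply: differentiable_sum => j.
exact/differentiableZl/differentiable_coord.
Qed.

(** A partial derivative in a fibre direction commutes with fixing [x], so the induction on [k] goes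
    through. *)
Lemma Ck_row_mx_r (R : realType) (m n k : nat) (x : 'rV[R]_m)
    (W : set 'rV[R]_(m + n)) (U : set 'rV[R]_n) (K : 'rV[R]_(m + n) -> R) :
  (forall y, U y -> W (row_mx x y)) -> Ck k W K ->
  Ck k U (fun y => K (row_mx x y)).
Proof.
move=> UW; elim: k K => [|k IH] K /=.
  move=> cK y /UW Wy; apply: (@continuous_comp _ _ _ (row_mx x) K).
    exact/differentiable_continuous/differentiable_row_mx_r.
  exact: cK.
move=> [dK pK]; split=> [y /UW Wy|a].
  apply: (@differentiable_comp _ _ _ _ (row_mx x) K).
    exact: differentiable_row_mx_r.
  exact: dK.
rewrite (_ : partial a _ =
    fun y => partial (rshift m a) K (row_mx x y)); first exact: IH.
have E (h : R) y : row_mx x (h *: (delta_mx 0 a : 'rV[R]_n) + y) =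
    h *: (delta_mx 0 (rshift m a) : 'rV[R]_(m + n)) + row_mx x y.
  apply/matrixP => u b; rewrite (ord1 u) [RHS]mxE [X in _ = X + _]mxE.
  rewrite -(splitK b); case: fintype.split => c /=.
    by rewrite !row_mxEl !mxE eq_lrshift andbF mulr0 add0r.
  by rewrite !row_mxEr !mxE eq_rshift.
apply/funext => y; rewrite /partial /derive.
by under [in LHS]eq_fun do rewrite /= E.
Qed.

(** * Euler identities for half the Hessian of a 2-homogeneous function *)

Section Hessian.
Context (R : realType) (n : nat).
Implicit Types (A : 'rV[R]_n -> R) (y : 'rV[R]_n).

(* For [A = L ^+ 2] this is the fundamental tensor of [L], and
   [half_hessian_partial] its Cartan tensor. *)
Definition half_hessian A y i j : R := 2^-1 * partial i (partial j A) y.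

Definition half_hessian_partial A y i j k : R :=
  2^-1 * partial k (fun z => half_hessian A z i j) y.

Definition slit : set 'rV[R]_n := [set y | y != 0].

Lemma open_slit : open slit.
Proof.
rewrite (_ : slit = ~` [set 0]); last first.
  by apply/seteqP; split => y /= /eqP.
by apply: closed_openC; exact/accessible_closed_set1/hausdorff_accessible.
Qed.

(** Euler is applied twice, to the 1-homogeneous [partial j A] and then to [A], whose degree 2
    cancels the factor [2^-1]. The sums are exchanged so that the outer derivative is contracted
    first. *)
Lemma half_hessian_euler A y :
  (forall t z, 0 < t -> A (t *: z) = t ^+ 2 * A z) ->
  Ck 2 slit A -> y != 0 ->
  \sum_i (\sum_j half_hessian A y i j * y 0 j) * y 0 i = A y.
Proof.
move=> hom [dA pA] y0.
have dp j : differentiable (partial j A) y by have [+ _] := pA j; apply.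
have E j : \sum_i y 0 i * partial i (partial j A) y = partial j A y.
  rewrite (@euler _ _ _ 1%N) ?mul1r// => t t0.
  rewrite (@partial_homogeneous _ _ _ 1%N)//; first exact: dA.
  by apply: dA; rewrite /slit /= scaler_eq0 negb_or gt_eqF.
rewrite (eq_bigr (fun i => \sum_j half_hessian A y i j * y 0 j * y 0 i));
  last by move=> i _; rewrite mulr_suml.
rewrite exchange_big /=.
rewrite (eq_bigr (fun j => 2^-1 * (y 0 j * partial j A y))); last first.
  move=> j _; rewrite -E mulr_sumr mulr_sumr; apply: eq_bigr => i _.
  by rewrite /half_hessian; ring.
rewrite -mulr_sumr (@euler _ _ _ 2%N)//; last by move=> t t0; exact: hom.
  by rewrite mulrA mulVf ?mul1r// pnatr_eq0.
exact: dA.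
Qed.

(* Contracting the middle derivative, by differentiating Euler's identity for
   the 1-homogeneous [partial j A], avoids the symmetry of second partials. *)
Lemma half_hessian_partial_euler A y j k :
  (forall t z, 0 < t -> A (t *: z) = t ^+ 2 * A z) ->
  Ck 3 slit A -> y != 0 ->
  \sum_i y 0 i * half_hessian_partial A y i j k = 0.
Proof.
move=> hom [dA /(_ j) [dH pH]] y0; set H := partial j A in dH pH *.
have ppH i : differentiable (partial i H) y by have [+ _] := pH i; apply.
have E (z : 'rV[R]_n) : z != 0 -> \sum_i z 0 i * partial i H z = H z.
  move=> z0; rewrite (@euler _ _ _ 1%N) ?mul1r//; first exact: dH.
  move=> t t0; rewrite /H.
  rewrite (@partial_homogeneous _ _ _ 1%N)//; first exact: dA.
  by apply: dA; rewrite /slit /= scaler_eq0 negb_or gt_eqF.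
(* Identity [E] holds only off the origin, but the slit space is open, so it may be differentiated
   at [y]. *)
have D : partial k (\sum_i ((fun z : 'rV[R]_n => z 0 i) * partial i H)) y =
         partial k H y.
  apply: (partial_eq_in _ open_slit); last by rewrite inE.
  by move=> z; rewrite inE fct_sumE; exact: E.
have dc i : derivable (fun z : 'rV[R]_n => z 0 i) y (delta_mx 0 k).
  exact/diff_derivable/differentiable_coord.
have dk i : derivable (partial i H) y (delta_mx 0 k) by exact: diff_derivable.
have c i : partial k (fun z : 'rV[R]_n => z 0 i) y = (i == k)%:R.
  have /matrixP/(_ 0 i) :=
    derive_mx (@derivable_id R 'rV[R]_n y (delta_mx 0 k)).
  by rewrite derive_id !mxE eqxx /= => ->.
have sum_delta (G : 'I_n -> R) : \sum_i G i * (i == k)%:R = G k.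
  rewrite (bigD1 k)//= eqxx mulr1 big1 ?addr0// => i /negbTE ->.
  by rewrite mulr0.
(* By Leibniz, differentiating the coordinates in [D] produces [partial k H y], which is the right
   side; what is left vanishes. *)
have S : \sum_i y 0 i * partial k (partial i H) y = 0.
  apply: (addrI (partial k H y)); rewrite addr0 -[RHS]D.
  rewrite [RHS](derive_sum (fun i => derivableM (dc i) (dk i))).
  rewrite [RHS](eq_bigr (fun i => y 0 i * partial k (partial i H) y +
                         partial i H y * (i == k)%:R)); last first.
    by move=> i _; rewrite deriveM// -c.
  rewrite big_split /= addrC; congr (_ + _).
  by rewrite (sum_delta (fun i => partial i H y)).
rewrite (eq_bigr (fun i => 2^-1 * 2^-1 * (y 0 i * partial k (partial i H) y))).
  by rewrite -mulr_sumr S mulr0.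
move=> i _; rewrite /half_hessian_partial /half_hessian.
have -> : partial k (fun z => 2^-1 * partial i (partial j A) z) y =
          2^-1 * partial k (partial i H) y by exact: (deriveMl _ (dk i)).
by ring.
Qed.

End Hessian.

(** The inverse metric does not involve the contracted index and comes out of the sum. The map [s]
    allows contraction over a single block, with [lshift] or [rshift]. *)
Lemma mean_cartan_contract (R : realType) (n : nat) (L : 'rV[R]_n -> R)
    (w : 'rV[R]_n) (I : finType) (s : I -> 'I_n) (z : I -> R) :
  (forall b c, \sum_i z i * cartan_tensor L w (s i) b c = 0) ->
  \sum_i z i * mean_cartan L w (s i) = 0.
Proof.
move=> E; rewrite /mean_cartan.
under eq_bigr => i _ do rewrite mulr_sumr.
rewrite exchange_big big1// => b _.
under eq_bigr => i _ do rewrite mulr_sumr.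
rewrite exchange_big big1// => c _.
under eq_bigr => i _ do rewrite mulrCA.
by rewrite -mulr_sumr E mulr0.
Qed.

(** * Tensors of a metric whose square splits as A(y) + B(v) *)

Section OrthogonalSum.
Context (R : realType) (n1 n2 : nat).
Implicit Types (A : 'rV[R]_n1 -> R) (B : 'rV[R]_n2 -> R).
Implicit Types (w : 'rV[R]_(n1 + n2)).

Definition orthogonal_sum A B w : R := A (lsubmx w) + B (rsubmx w).

(* The other summand cancels in the difference quotient, so these two hold
   without any differentiability hypothesis. *)
Lemma partial_orthogonal_sum_l A B i :
  partial (lshift n2 i) (orthogonal_sum A B) = fun w => partial i A (lsubmx w).
Proof.
apply/funext => w; rewrite /partial /derive.
set e : 'rV[R]_(n1 + n2) := delta_mx 0 (lshift n2 i).
have El (h : R) : lsubmx (h *: e + w) =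
    h *: (delta_mx 0 i : 'rV[R]_n1) + lsubmx w.
  by apply/matrixP => u v; rewrite !mxE eq_lshift.
have Er (h : R) : rsubmx (h *: e + w) = rsubmx w.
  by apply/matrixP => u v; rewrite !mxE eq_rlshift andbF mulr0 add0r.
have D (a b c : R) : a + b - (c + b) = a - c by ring.
by under eq_fun do rewrite /= /orthogonal_sum El Er D.
Qed.

Lemma partial_orthogonal_sum_r A B j :
  partial (rshift n1 j) (orthogonal_sum A B) = fun w => partial j B (rsubmx w).
Proof.
apply/funext => w; rewrite /partial /derive.
set e : 'rV[R]_(n1 + n2) := delta_mx 0 (rshift n1 j).
have El (h : R) : lsubmx (h *: e + w) = lsubmx w.
  by apply/matrixP => u v; rewrite !mxE eq_lrshift andbF mulr0 add0r.
have Er (h : R) : rsubmx (h *: e + w) =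
    h *: (delta_mx 0 j : 'rV[R]_n2) + rsubmx w.
  by apply/matrixP => u v; rewrite !mxE eq_rshift.
have D (a b c : R) : a + b - (a + c) = b - c by ring.
by under eq_fun do rewrite /= /orthogonal_sum El Er D.
Qed.

(** A function of one block is an orthogonal sum with 0. The pair lets one rewriting rule serve both
    kinds of index. *)
Lemma partial_comp_lsubmx A :
  (forall i, partial (lshift n2 i) (fun w => A (lsubmx w)) =
             fun w => partial i A (lsubmx w)) *
  (forall j, partial (rshift n1 j) (fun w => A (lsubmx w)) = fun=> 0).
Proof.
have -> : (fun w => A (lsubmx w)) = orthogonal_sum A (fun=> 0).
  by apply/funext => w; rewrite /orthogonal_sum addr0.
split=> [i|j]; first by rewrite partial_orthogonal_sum_l.
by rewrite partial_orthogonal_sum_r partial_cst.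
Qed.

Lemma partial_comp_rsubmx B :
  (forall i, partial (lshift n2 i) (fun w => B (rsubmx w)) = fun=> 0) *
  (forall j, partial (rshift n1 j) (fun w => B (rsubmx w)) =
             fun w => partial j B (rsubmx w)).
Proof.
have -> : (fun w => B (rsubmx w)) = orthogonal_sum (fun=> 0) B.
  by apply/funext => w; rewrite /orthogonal_sum add0r.
split=> [i|j]; last by rewrite partial_orthogonal_sum_r.
by rewrite partial_orthogonal_sum_l partial_cst.
Qed.

Section Tensors.
Variables (L : 'rV[R]_(n1 + n2) -> R) (A : 'rV[R]_n1 -> R) (B : 'rV[R]_n2 -> R).
Hypothesis sqrL : forall w, L w ^+ 2 = orthogonal_sum A B w.

Let sqrLE : (fun w => L w ^+ 2) = orthogonal_sum A B.
Proof. exact/funext. Qed.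

Lemma fundamental_tensor_ll w i j :
  fundamental_tensor L w (lshift n2 i) (lshift n2 j) =
  half_hessian A (lsubmx w) i j.
Proof.
by rewrite mxE sqrLE partial_orthogonal_sum_l partial_comp_lsubmx.
Qed.

Lemma fundamental_tensor_rr w i j :
  fundamental_tensor L w (rshift n1 i) (rshift n1 j) =
  half_hessian B (rsubmx w) i j.
Proof.
by rewrite mxE sqrLE partial_orthogonal_sum_r partial_comp_rsubmx.
Qed.

Lemma fundamental_tensor_lr w i j :
  fundamental_tensor L w (lshift n2 i) (rshift n1 j) = 0.
Proof.
by rewrite mxE sqrLE partial_orthogonal_sum_r partial_comp_rsubmx mulr0.
Qed.

Lemma fundamental_tensor_rl w i j :
  fundamental_tensor L w (rshift n1 i) (lshift n2 j) = 0.
Proof.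
by rewrite mxE sqrLE partial_orthogonal_sum_l partial_comp_lsubmx mulr0.
Qed.

Lemma cartan_tensor_lll w i j k :
  cartan_tensor L w (lshift n2 i) (lshift n2 j) (lshift n2 k) =
  half_hessian_partial A (lsubmx w) i j k.
Proof.
rewrite /cartan_tensor (funext (fun z => fundamental_tensor_ll z i j)).
by rewrite (partial_comp_lsubmx (fun y => half_hessian A y i j)).
Qed.

Lemma cartan_tensor_rrr w i j k :
  cartan_tensor L w (rshift n1 i) (rshift n1 j) (rshift n1 k) =
  half_hessian_partial B (rsubmx w) i j k.
Proof.
rewrite /cartan_tensor (funext (fun z => fundamental_tensor_rr z i j)).
by rewrite (partial_comp_rsubmx (fun y => half_hessian B y i j)).
Qed.

Lemma cartan_tensor_llr w i j k :
  cartan_tensor L w (lshift n2 i) (lshift n2 j) (rshift n1 k) = 0.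
Proof.
rewrite /cartan_tensor (funext (fun z => fundamental_tensor_ll z i j)).
by rewrite (partial_comp_lsubmx (fun y => half_hessian A y i j)) mulr0.
Qed.

Lemma cartan_tensor_rrl w i j k :
  cartan_tensor L w (rshift n1 i) (rshift n1 j) (lshift n2 k) = 0.
Proof.
rewrite /cartan_tensor (funext (fun z => fundamental_tensor_rr z i j)).
by rewrite (partial_comp_rsubmx (fun y => half_hessian B y i j)) mulr0.
Qed.

(** The mixed metric components vanish at every [w], hence so do their derivatives. With
    [cartan_tensor_rl], [cartan_tensor_llr] and [cartan_tensor_rrl] this covers all mixed components
    without appeal to symmetry. *)
Lemma cartan_tensor_lr w i j c :
  cartan_tensor L w (lshift n2 i) (rshift n1 j) c = 0.
Proof.
rewrite /cartan_tensor (funext (fun z => fundamental_tensor_lr z i j)).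
by rewrite partial_cst mulr0.
Qed.

Lemma cartan_tensor_rl w i j c :
  cartan_tensor L w (rshift n1 i) (lshift n2 j) c = 0.
Proof.
rewrite /cartan_tensor (funext (fun z => fundamental_tensor_rl z i j)).
by rewrite partial_cst mulr0.
Qed.

Hypothesis homA : forall t y, 0 < t -> A (t *: y) = t ^+ 2 * A y.
Hypothesis homB : forall t y, 0 < t -> B (t *: y) = t ^+ 2 * B y.
Hypothesis CkA : Ck 3 (@slit R n1) A.
Hypothesis CkB : Ck 3 (@slit R n2) B.
Variable w : 'rV[R]_(n1 + n2).
Hypothesis wl : lsubmx w != 0.
Hypothesis wr : rsubmx w != 0.

Lemma cartan_tensor_contract_l b c :
  \sum_i lsubmx w 0 i * cartan_tensor L w (lshift n2 i) b c = 0.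
Proof.
rewrite -(splitK b); case: fintype.split => j /=; last first.
  by apply: big1 => i _; rewrite cartan_tensor_lr mulr0.
rewrite -(splitK c); case: fintype.split => k /=; last first.
  by apply: big1 => i _; rewrite cartan_tensor_llr mulr0.
rewrite -[RHS](half_hessian_partial_euler j k homA CkA wl).
by apply: eq_bigr => i _; rewrite cartan_tensor_lll.
Qed.

Lemma cartan_tensor_contract_r b c :
  \sum_i rsubmx w 0 i * cartan_tensor L w (rshift n1 i) b c = 0.
Proof.
rewrite -(splitK b); case: fintype.split => j /=.
  by apply: big1 => i _; rewrite cartan_tensor_rl mulr0.
rewrite -(splitK c); case: fintype.split => k /=.
  by apply: big1 => i _; rewrite cartan_tensor_rrl mulr0.
rewrite -[RHS](half_hessian_partial_euler j k homB CkB wr).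
by apply: eq_bigr => i _; rewrite cartan_tensor_rrr.
Qed.

(** The metric is block diagonal, so only the half Hessian of [A] enters and its Euler identity
    applies. *)
Lemma lowered_contract_l :
  \sum_i lsubmx w 0 i * lowered L w (lshift n2 i) = A (lsubmx w).
Proof.
rewrite -[RHS](half_hessian_euler homA (CkS_Ck CkA) wl).
apply: eq_bigr => i _; rewrite mulrC /lowered big_split_ord /=; congr (_ * _).
rewrite [X in _ + X]big1 ?addr0.
  by apply: eq_bigr => j _; rewrite fundamental_tensor_ll mxE.
by move=> j _; rewrite fundamental_tensor_lr mul0r.
Qed.

Lemma lowered_contract_r :
  \sum_i rsubmx w 0 i * lowered L w (rshift n1 i) = B (rsubmx w).
Proof.
rewrite -[RHS](half_hessian_euler homB (CkS_Ck CkB) wr).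
apply: eq_bigr => i _; rewrite mulrC /lowered big_split_ord /=; congr (_ * _).
rewrite [X in X + _]big1 ?add0r.
  by apply: eq_bigr => j _; rewrite fundamental_tensor_rr mxE.
by move=> j _; rewrite fundamental_tensor_rl mul0r.
Qed.

Hypothesis matsumoto0 : forall a b c, matsumoto_tensor L w a b c = 0.
Hypothesis Aw : A (lsubmx w) != 0.
Hypothesis Bw : B (rsubmx w) != 0.
Hypothesis Lw : L w != 0.

Lemma mean_cartan_eq0 a : mean_cartan L w a = 0.
Proof.
pose y i := lsubmx w 0 i; pose v j := rsubmx w 0 j.
pose I := mean_cartan L w; pose l := lowered L w.
have ylE : \sum_i y i * l (lshift n2 i) = A (lsubmx w) := lowered_contract_l.
have vlE : \sum_i v i * l (rshift n1 i) = B (rsubmx w) := lowered_contract_r.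
have yI : \sum_i y i * I (lshift n2 i) = 0.
  exact: mean_cartan_contract cartan_tensor_contract_l.
have vI : \sum_i v i * I (rshift n1 i) = 0.
  exact: mean_cartan_contract cartan_tensor_contract_r.
pose h := angular_metric L w.
have hE j k : h (lshift n2 j) (rshift n1 k) =
    - (L w ^+ 2)^-1 * (l (lshift n2 j) * l (rshift n1 k)).
  by rewrite /h /angular_metric fundamental_tensor_lr sub0r mulNr.
(* Whichever block [a] lies in, the triple (a, j, k) meets both blocks, so its Cartan component is
   0; the nonzero factor 1/(n+1) is then cleared. *)
have E j k : I a * h (lshift n2 j) (rshift n1 k) +
    I (lshift n2 j) * h a (rshift n1 k) +
    I (rshift n1 k) * h a (lshift n2 j) = 0.
  have := matsumoto0 a (lshift n2 j) (rshift n1 k).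
  rewrite /matsumoto_tensor (_ : cartan_tensor _ _ _ _ _ = 0) ?sub0r.
    by move=> /eqP; rewrite oppr_eq0 mulf_eq0 invr_eq0 pnatr_eq0 /= => /eqP.
  rewrite -(splitK a); case: fintype.split => i /=.
    exact: cartan_tensor_llr.
  exact: cartan_tensor_rl.
have : \sum_j \sum_k y j * v k * (I a * h (lshift n2 j) (rshift n1 k) +
    I (lshift n2 j) * h a (rshift n1 k) +
    I (rshift n1 k) * h a (lshift n2 j)) = 0.
  by rewrite big1// => j _; rewrite big1// => k _; rewrite E mulr0.
(* Each of the three terms is a function of j times a function of k, so the double sum splits into
   products of single sums. *)
have -> : \sum_j \sum_k y j * v k * (I a * h (lshift n2 j) (rshift n1 k) +
    I (lshift n2 j) * h a (rshift n1 k) +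
    I (rshift n1 k) * h a (lshift n2 j)) =
  - (L w ^+ 2)^-1 * I a * ((\sum_j y j * l (lshift n2 j)) *
                            (\sum_k v k * l (rshift n1 k))) +
  (\sum_j y j * I (lshift n2 j)) * (\sum_k v k * h a (rshift n1 k)) +
  (\sum_j y j * h a (lshift n2 j)) * (\sum_k v k * I (rshift n1 k)).
  rewrite !big_distrlr /= mulr_sumr -!big_split /=; apply: eq_bigr => j _.
  rewrite mulr_sumr -!big_split /=; apply: eq_bigr => k _.
  by rewrite hE; ring.
rewrite ylE vlE yI vI mul0r mulr0 !addr0 => /eqP.
rewrite !mulf_eq0 oppr_eq0 invr_eq0 expf_eq0 /= (negbTE Aw) (negbTE Bw).
by rewrite (negbTE Lw) /= orbF => /eqP.
Qed.

Lemma cartan_tensor_eq0 a b c : cartan_tensor L w a b c = 0.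
Proof.
have := matsumoto0 a b c; rewrite /matsumoto_tensor !mean_cartan_eq0.
by rewrite !mul0r !addr0 mulr0 subr0.
Qed.

End Tensors.
End OrthogonalSum.

(** * A Finsler metric on a single fibre *)

Section FinslerFibre.
Context (R : realType) (n : nat) (M : manifold R n) (F : tangent_function M).
Hypothesis finF : finsler_metric F.
Variables (i : chart M) (p : M).
Hypothesis ip : dom i p.

Lemma finsler_fibre_Ck k : Ck k (@slit R n) (F i p).
Proof.
have := finsler_smooth finF i k.
move=> /(Ck_row_mx_r (x := Defs.coord i p) (U := @slit R n)) H.
have -> : F i p = fun y => F i (param i (lsubmx (row_mx (Defs.coord i p) y)))
                     (rsubmx (row_mx (Defs.coord i p) y)).
  by apply/funext => y; rewrite row_mxKl row_mxKr coordK.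
by apply: H => y y0 /=; rewrite row_mxKl row_mxKr; split => //; exists p.
Qed.

(** The constant [c] stands for the value of [f ^+ 2] at the base point on the second factor, and
    for 1 on the first. *)
Lemma finsler_sqr_Ck k (c : R) :
  Ck k (@slit R n) (fun y => c * F i p y ^+ 2).
Proof.
apply: Ck_mul; [exact: open_slit | exact: Ck_cst |].
by under eq_fun do rewrite expr2;
  apply: Ck_mul; [exact: open_slit | exact: finsler_fibre_Ck..].
Qed.

Lemma finsler_sqr_homogeneous (c t : R) y : 0 < t ->
  c * F i p (t *: y) ^+ 2 = t ^+ 2 * (c * F i p y ^+ 2).
Proof. by move=> t0; rewrite (finsler_homogeneous finF)// exprMn mulrCA. Qed.

(** By Euler the square is g_y(y, y), positive by definiteness. [finsler_metric] says nothing on the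
    sign of [F], hence the square. *)
Lemma finsler_sqr_gt0 y : y != 0 -> 0 < F i p y ^+ 2.
Proof.
move=> y0; have := finsler_positive_definite finF ip y0 y0.
have hom t z : 0 < t -> F i p (t *: z) ^+ 2 = t ^+ 2 * F i p z ^+ 2.
  by move=> t0; have := finsler_sqr_homogeneous 1 z t0; rewrite !mul1r.
have Ck2 : Ck 2 (@slit R n) (fun y => F i p y ^+ 2).
  have := finsler_sqr_Ck 2 1.
  by under eq_fun do rewrite mul1r.
rewrite -(half_hessian_euler hom Ck2 y0) mxE.
rewrite (eq_bigr (fun b => \sum_a y 0 a * fundamental_tensor (F i p) y a b *
                                  y 0 b)); last first.
  by move=> b _; rewrite mxE mulr_suml [y^T _ _]mxE.
rewrite exchange_big /=; congr (0 < _); apply: eq_bigr => a _.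
rewrite mulr_suml; apply: eq_bigr => b _.
by rewrite [fundamental_tensor _ _ _ _]mxE -mulrA mulrC.
Qed.

End FinslerFibre.

Local Close Scope classical_set_scope.

Theorem theorem1 (R : realType) (n1 n2 : nat)
    (M1 : manifold R n1) (M2 : manifold R n2)
    (F1 : tangent_function M1) (F2 : tangent_function M2)
    (f : prod_manifold M1 M2 -> R) :
  finsler_metric F1 -> finsler_metric F2 ->
  smooth_function f -> (forall p, 0 < f p) ->
  ~ c_reducible (@twisted_slit R n1 n2) (twisted_product F1 F2 f).
Proof.
move=> fin1 fin2 _ f0 [[i [p [w [a [b [c [Dip [wl wr] cartan]]]]]]] mat].
(* It remains to show that the Cartan component assumed nonzero vanishes. *)
apply: cartan.
have [D1 D2] := Dip.
have gt1 := finsler_sqr_gt0 fin1 D1 wl.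
have gt2 := finsler_sqr_gt0 fin2 D2 wr.
have f2 : 0 < f p ^+ 2 by rewrite exprn_gt0.
(* The factor 1 gives [A] the same shape as [B], so that the lemmas on [c * F ^+ 2] apply to
   both. *)
pose A y := 1 * F1 i.1 p.1 y ^+ 2.
pose B v := f p ^+ 2 * F2 i.2 p.2 v ^+ 2.
have A0 : A (lsubmx w) != 0 by rewrite /A mul1r gt_eqF.
have B0 : B (rsubmx w) != 0 by rewrite /B gt_eqF// mulr_gt0.
apply: (@cartan_tensor_eq0 _ _ _ _ A B) => //.
- move=> z; rewrite /= /twisted_fun sqr_sqrtr.
    by rewrite /orthogonal_sum /A mul1r.
  by apply: addr_ge0; [exact: sqr_ge0 | exact/mulr_ge0/sqr_ge0/sqr_ge0].
- by move=> t y t0; exact: finsler_sqr_homogeneous.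
- by move=> t y t0; exact: finsler_sqr_homogeneous.
- exact: finsler_sqr_Ck.
- exact: finsler_sqr_Ck.
- by move=> a' b' c'; exact: mat.
- by rewrite /= /twisted_fun sqrtr_eq0 -ltNge addr_gt0// mulr_gt0.
Qed.
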